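(* Let $\mathbf{S}=(S_{\boldsymbol{\alpha}})_{\boldsymbol{\alpha}}$ be an optimal solution of the $r$-th order correlative sparsity adapted moment relaxation (with optimal value $\lambda_r^{(\mathrm{cs})}$), $r\ge r_{\min}$, of the polynomial matrix optimization problem with optimal value $\lambda^\star$. Assume: (i) for each $\ell\in[t]$, the sequence $\mathbf{S}^{\ell}:=(S_{\boldsymbol{\alpha}})_{\mathrm{supp}(\boldsymbol{\alpha})\subseteq\mathcal{I}_\ell}$ admits a representing measure $\Phi_\ell=S_{\mathbf{0}}\left(\sum_{i=1}^{s_\ell}\xi_{i\ell}\,\delta_{\boldsymbol{x}^i(\ell)}\right)$ for some $\xi_{i\ell}>0$ with $\sum_{i=1}^{s_\ell}\xi_{i\ell}=1$ and some $\boldsymbol{x}^1(\ell),\ldots,\boldsymbol{x}^{s_\ell}(\ell)\in\mathbf{K}_\ell$; (ii) for all pairs $\{i,j\}$ (of distinct indices in $[t]$) with $\mathcal{I}_i\cap\mathcal{I}_j\neq\emptyset$, one has $\mathrm{rank}\,M_r(\mathbf{S},\mathcal{I}_i\cap\mathcal{I}_j)=1$. Then $\lambda_r^{(\mathrm{cs})}=\lambda^\star$. Moreover, each point $\hat{\boldsymbol{x}}\in\mathbb{R}^n$ satisfying, for every $\ell\in[t]$, $\hat{\boldsymbol{x}}(\ell):=(\hat x_i)_{i\in\mathcal{I}_\ell}=\boldsymbol{x}^{i_\ell}(\ell)$ for some $i_\ell\in[s_\ell]$, is an optimal solution of the polynomial matrix optimization problem.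
   Context: **Problem.** $\lambda^\star:=\inf_{\boldsymbol{x}\in\mathbb{R}^n}\lambda_{\min}(F(\boldsymbol{x}))$ s.t. $G_1(\boldsymbol{x})\succeq0,\ldots,G_m(\boldsymbol{x})\succeq0$, where $F$ is a symmetric $p\times p$ real polynomial matrix, $G_k$ a symmetric $q_k\times q_k$ real polynomial matrix, and $\lambda_{\min}$ is the smallest eigenvalue. An optimal solution is a feasible point $\boldsymbol{x}$ with $\lambda_{\min}(F(\boldsymbol{x}))=\lambda^\star$. Set $d_k=\lceil\deg G_k/2\rceil$ (degree = maximum degree of entries), $r_{\min}=\max\{\lceil\deg F/2\rceil,d_1,\ldots,d_m\}$, $[t]=\{1,\ldots,t\}$, $|\boldsymbol{\alpha}|=\sum_i\alpha_i$, $\mathbb{N}^n_d=\{\boldsymbol{\alpha}\in\mathbb{N}^n:|\boldsymbol{\alpha}|\le d\}$. For a multi-index, $\mathrm{supp}(\boldsymbol{\alpha})=\{k:\alpha_k\ne0\}$. Write $F=\sum_{\boldsymbol{\alpha}}F_{\boldsymbol{\alpha}}\boldsymbol{x}^{\boldsymbol{\alpha}}$, $G_k=\sum_{\boldsymbol{\gamma}}(G_k)_{\boldsymbol{\gamma}}\boldsymbol{x}^{\boldsymbol{\gamma}}$ with matrix coefficients. **Correlative sparsity.** The CSP graph has vertex set $[n]$; $i,j$ are adjacent if $i,j\in\mathrm{supp}(\boldsymbol{\alpha})$ for some $\boldsymbol{\alpha}$ with $F_{\boldsymbol{\alpha}}\neq0$, or if $x_i,x_j$ both effectively occur in some $G_k$.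 $\mathcal{I}_1,\ldots,\mathcal{I}_t$ are its maximal cliques. $[m]$ is partitioned into pairwise disjoint sets $\mathcal{J}_1,\ldots,\mathcal{J}_t$ such that for $k\in\mathcal{J}_\ell$ all variables of $G_k$ have index in $\mathcal{I}_\ell$. $\mathbf{K}_\ell=\{\boldsymbol{x}(\ell)=(x_i)_{i\in\mathcal{I}_\ell}\in\mathbb{R}^{|\mathcal{I}_\ell|}: G_k\succeq0\ \forall k\in\mathcal{J}_\ell\}$. **Relaxation.** For $\mathbf{S}=(S_{\boldsymbol{\alpha}})_{\boldsymbol{\alpha}\in\mathbb{N}^n_{2r}}$ with $S_{\boldsymbol{\alpha}}$ real symmetric $p\times p$, $\mathscr{L}_{\mathbf{S}}(F)=\sum_{\boldsymbol{\alpha}}\mathrm{tr}(F_{\boldsymbol{\alpha}}S_{\boldsymbol{\alpha}})$. For $\mathcal{I}\subseteq[n]$, $M_d(\mathbf{S},\mathcal{I})$ is the block matrix with blocks indexed by $\boldsymbol{\alpha},\boldsymbol{\beta}\in\mathbb{N}^n_d$ with supports in $\mathcal{I}$, whose $(\boldsymbol{\alpha},\boldsymbol{\beta})$ block is $S_{\boldsymbol{\alpha}+\boldsymbol{\beta}}$; $M_d(G\mathbf{S},\mathcal{I})$ is the analogous block matrix with blocks $\sum_{\boldsymbol{\gamma}}S_{\boldsymbol{\alpha}+\boldsymbol{\beta}+\boldsymbol{\gamma}}\otimes G_{\boldsymbol{\gamma}}$. The $r$-th order relaxation is $$\lambda_r^{(\mathrm{cs})}:=\inf_{\mathbf{S}}\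 \mathscr{L}_{\mathbf{S}}(F)\ \text{ s.t. } M_r(\mathbf{S},\mathcal{I}_\ell)\succeq0\ (\ell\in[t]),\ M_{r-d_k}(G_k\mathbf{S},\mathcal{I}_\ell)\succeq0\ (k\in\mathcal{J}_\ell,\ \ell\in[t]),\ \mathscr{L}_{\mathbf{S}}(I_p)=1.$$ **Measures.** A finitely atomic PSD matrix-valued measure on $\mathbf{K}_\ell$ is $\Phi=\sum_iW_i\delta_{\boldsymbol{x}^i}$ with $W_i$ PSD $p\times p$ and $\boldsymbol{x}^i\in\mathbf{K}_\ell$. It is a representing measure of $\mathbf{S}^\ell=(S_{\boldsymbol{\alpha}})_{|\boldsymbol{\alpha}|\le2r,\ \mathrm{supp}(\boldsymbol{\alpha})\subseteq\mathcal{I}_\ell}$ if $S_{\boldsymbol{\alpha}}=\int\boldsymbol{x}^{\boldsymbol{\alpha}}\,\mathrm{d}\Phi=\sum_iW_i(\boldsymbol{x}^i)^{\boldsymbol{\alpha}}$ for all such $\boldsymbol{\alpha}$. *)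

(* Defs.v *)
From HB Require Import structures.
From mathcomp Require Import all_boot all_order all_algebra.
(* [mpoly] has to come before the files of MathComp-Analysis: in the opposite
   order the two sets of notations have incompatible parsing levels. *)
From mathcomp Require Import mxtens mpoly.
From mathcomp Require Import boolp classical_sets reals constructive_ereal ereal.

Set Implicit Arguments.
Unset Strict Implicit.
Unset Printing Implicit Defensive.

Import Order.TTheory GRing.Theory Num.Theory.

Local Open Scope ring_scope.

Section RealMatrices.
Context {R : realType}.

Definition psd {k : nat} (A : 'M[R]_k) : Prop :=
  A^T = A /\ forall u : 'rV[R]_k, 0 <= (u *m A *m u^T) 0 0.

(* For a symmetric A of positive size the set of eigenvalues is finite and
   nonempty, so that this infimum is a minimum. *)
Definition lambda_min {k : nat} (A : 'M[R]_k) : R :=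
  inf [set a | eigenvalue A a]%classic.

End RealMatrices.

Section PolynomialMatrices.
Context {R : realType} {n : nat}.

Definition supp (a : 'X_{1..n}) : {set 'I_n} := [set i | a i != 0%N].

(* [msize] is 1 + the degree; the zero matrix has degree 0. *)
Definition mxdegree {k : nat} (P : 'M[{mpoly R[n]}]_k) : nat :=
  \max_(i < k) \max_(j < k) (msize (P i j)).-1.

Definition half_degree {k : nat} (P : 'M[{mpoly R[n]}]_k) : nat :=
  uphalf (mxdegree P).

Definition mxcoef {k : nat} (P : 'M[{mpoly R[n]}]_k) (a : 'X_{1..n}) : 'M[R]_k :=
  map_mx (mcoeff a) P.

Definition mxeval {k : nat} (P : 'M[{mpoly R[n]}]_k) (x : 'rV[R]_n) : 'M[R]_k :=
  map_mx (meval (fun i => x 0 i)) P.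

Definition occurs {k : nat} (P : 'M[{mpoly R[n]}]_k) (i : 'I_n) : Prop :=
  exists2 a : 'X_{1..n}, mxcoef P a != 0 & i \in supp a.

End PolynomialMatrices.

Section Problem.
Context {R : realType} {n p m : nat} {q : 'I_m -> nat}.
Variables (F : 'M[{mpoly R[n]}]_p) (G : forall k : 'I_m, 'M[{mpoly R[n]}]_(q k)).

Definition feasible (x : 'rV[R]_n) : Prop := forall k, psd (mxeval (G k) x).

Definition pmo_value : \bar R :=
  ereal_inf [set (lambda_min (mxeval F x))%:E | x in [set x | feasible x]]%classic.

Definition pmo_optimal (x : 'rV[R]_n) : Prop :=
  feasible x /\ (lambda_min (mxeval F x))%:E = pmo_value.

Definition r_min : nat :=
  maxn (half_degree F) (\max_(k < m) half_degree (G k)).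

Definition csp_adj (i j : 'I_n) : Prop :=
  i != j /\
  ((exists2 a : 'X_{1..n}, mxcoef F a != 0 & (i \in supp a) && (j \in supp a))
   \/ (exists k, occurs (G k) i /\ occurs (G k) j)).

Definition csp_clique (A : {set 'I_n}) : Prop :=
  forall i j, i \in A -> j \in A -> i != j -> csp_adj i j.

Definition csp_maxclique (A : {set 'I_n}) : Prop :=
  csp_clique A /\ forall B : {set 'I_n}, csp_clique B -> A \subset B -> A = B.

(* The blocks J l of the partition of the constraints may be empty. *)
Record csp_decomposition {t : nat} (I : 'I_t -> {set 'I_n})
    (J : 'I_t -> {set 'I_m}) : Prop := {
  csp_injective : injective I;
  csp_cliques : forall A, csp_maxclique A <-> exists l, A = I l;
  csp_disjoint : forall l l', l != l' -> [disjoint J l & J l'];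
  csp_cover : forall k, exists l, k \in J l;
  csp_vars : forall l k i, k \in J l -> occurs (G k) i -> i \in I l }.

End Problem.

Section Moments.
Context {R : realType} {n p r : nat}.

(* Truncated matrix sequences, indexed by the multi-indices of degree <= 2r. *)
Definition moment_seq : Type := {ffun 'X_{1..n < (2 * r).+1} -> 'M[R]_p}.

Implicit Types (S : moment_seq) (A : {set 'I_n}).

(* S_a for an arbitrary multi-index a. The default value 0 is a totality
   convention: the matrices below only use it beyond degree 2r, which does not
   happen when d <= r, resp. d + half_degree P <= r. *)
Definition entry S (a : 'X_{1..n}) : 'M[R]_p :=
  if insub a is Some b then S b else 0.

(* Only the coefficients of degree <= 2r of P enter, hence all of them when
   half_degree P <= r. *)
Definition riesz S (P : 'M[{mpoly R[n]}]_p) : R :=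
  \sum_(a : 'X_{1..n < (2 * r).+1}) \tr (mxcoef P a *m S a).

Definition mbasis (d : nat) A : {set 'X_{1..n < d.+1}} :=
  [set a : 'X_{1..n < d.+1} | supp a \subset A].

Definition mindex {d : nat} {A} (i : 'I_#|mbasis d A|) : 'X_{1..n} :=
  enum_val i.

Definition moment_mx S (d : nat) A :=
  \mxblock_(i < #|mbasis d A|, j < #|mbasis d A|)
    entry S (mindex i + mindex j)%MM.

Definition localizing_mx S {k : nat} (P : 'M[{mpoly R[n]}]_k) (d : nat) A :=
  \mxblock_(i < #|mbasis d A|, j < #|mbasis d A|)
    \sum_(c : 'X_{1..n < (mxdegree P).+1})
      (entry S (mindex i + mindex j + c)%MM *t mxcoef P c).

End Moments.

Arguments moment_seq : clear implicits.

Section Relaxation.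
Context {R : realType} {n p m t : nat} {q : 'I_m -> nat}.
Variables (F : 'M[{mpoly R[n]}]_p) (G : forall k : 'I_m, 'M[{mpoly R[n]}]_(q k)).
Variables (I : 'I_t -> {set 'I_n}) (J : 'I_t -> {set 'I_m}) (r : nat).

Record cs_feasible (S : moment_seq R n p r) : Prop := {
  cs_sym : forall a, (S a)^T = S a;
  cs_moment : forall l, psd (moment_mx S r (I l));
  cs_localizing : forall l k, k \in J l ->
    psd (localizing_mx S (G k) (r - half_degree (G k)) (I l));
  cs_normalized : riesz S (1%:M) = 1 }.

Definition cs_value : \bar R :=
  ereal_inf [set (riesz S F)%:E | S in [set S | cs_feasible S]]%classic.

Definition cs_optimal (S : moment_seq R n p r) : Prop :=
  cs_feasible S /\ (riesz S F)%:E = cs_value.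

End Relaxation.

(* The points (x_i)_{i \in A} are row vectors of size #|A|; coordinate j
   corresponds to the variable of index enum_val j. *)
Section Subvectors.
Context {R : realType} {n : nat}.

Definition subvec (A : {set 'I_n}) (x : 'rV[R]_n) : 'rV[R]_#|A| :=
  \row_j x 0 (enum_val j).

(* Extension by 0 outside A; it allows a polynomial whose variables lie in A
   to be evaluated at y. *)
Definition extend {A : {set 'I_n}} (y : 'rV[R]_#|A|) : 'rV[R]_n :=
  \row_i \sum_(j < #|A| | enum_val j == i) y 0 j.

(* y ^ a, for a multi-index a supported in A. *)
Definition submonomial {A : {set 'I_n}} (a : 'X_{1..n}) (y : 'rV[R]_#|A|) : R :=
  \prod_(j < #|A|) y 0 j ^+ a (enum_val j).

Definition local_set {m : nat} {q : 'I_m -> nat}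
    (G : forall k : 'I_m, 'M[{mpoly R[n]}]_(q k))
    (A : {set 'I_n}) (B : {set 'I_m}) : set 'rV[R]_#|A| :=
  [set y | forall k, k \in B -> psd (mxeval (G k) (extend y))]%classic.

(* The measure \sum_i W i \delta_(y i) is a finitely atomic PSD matrix-valued
   measure on K and represents the subsequence (S_a)_{supp a \subset A}. *)
Record representing_measure {p r : nat} (S : moment_seq R n p r)
    (A : {set 'I_n}) (K : set 'rV[R]_#|A|) {s : nat}
    (W : 'I_s -> 'M[R]_p) (y : 'I_s -> 'rV[R]_#|A|) : Prop := {
  rm_psd : forall i, psd (W i);
  rm_atoms : forall i, K (y i);
  rm_moments : forall a : 'X_{1..n < (2 * r).+1}, supp a \subset A ->
    S a = \sum_(i < s) submonomial a (y i) *: W i }.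

End Subvectors.

Arguments local_set {R n m q} G A B.

(* Main.v *)
Require Import Defs.
From HB Require Import structures.
From mathcomp Require Import all_boot all_order all_algebra.
From mathcomp Require Import mxtens mpoly.
From mathcomp Require Import spectral complex zify ring.
From mathcomp Require Import boolp classical_sets reals constructive_ereal ereal.

Set Implicit Arguments.
Unset Strict Implicit.
Unset Printing Implicit Defensive.

Import Order.TTheory GRing.Theory Num.Theory.

Local Open Scope ring_scope.

(**
A unit eigenvector of [F z] for its least eigenvalue turns a feasible point [z]
into a feasible point of the relaxation of value [lambda_min (F z)], so the
relaxation is a lower bound. Conversely, the rank-one condition forces every
coordinate shared by two cliques to be constant on the atoms of both measures
(its variance is a vanishing 2x2 minor), hence any choice of one atom per clique
glues to a feasible point [z]. Attributing each monomial of [F] to one clique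
writes [tr (F z S_0)] as a sum, over the cliques, of a function [h l] of the
chosen atom, and the relaxed value as the sum of the means of the [h l]. Since
every choice gives [tr (F z S_0) >= lambda_min (F z) >=] the relaxed value, each
[h l] is equal to its mean on all atoms, and equality holds throughout.
*)

(** * Spectral theory of real symmetric matrices *)

Section SymmetricMatrices.
Context {R : realType}.
Local Open Scope sesquilinear_scope.

(** Over the complex numbers [A] is hermitian, hence unitarily diagonalizable with real spectrum. As
    [A] is real, the real and imaginary parts of each complex eigenvector satisfy the same
    eigenvalue equation. The boolean index selects the part, so the [w k] number 2p and may vanish
    or fail to be orthogonal. *)
Lemma sym_eigen_decomposition {p : nat} (A : 'M[R]_p) : A^T = A ->
  exists (d : 'I_p -> R) (w : bool * 'I_p -> 'rV[R]_p),
    [/\ forall k, w k *m A = d k.2 *: w k,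
        A = \sum_k d k.2 *: ((w k)^T *m w k) &
        1%:M = \sum_k (w k)^T *m w k].
Proof.
move=> Asym; pose B : 'M[R[i]]_p := map_mx (real_complex R) A.
have Bherm : B \is hermsymmx.
  apply: realsym_hermsym; last first.
    by apply/mxOverP => i j; rewrite !mxE complex_real.
  apply/is_hermitianmxP.
  by rewrite expr0 scale1r map_mx_id // /B map_trmx Asym.
have Breal := hermitian_spectral_diag_real Bherm.
have /orthomx_spectralP := hermitian_normalmx Bherm.
move: Breal (spectral_unitarymx B).
move: (spectralmx B) (spectral_diag B) => P D Dreal Pu BE.
rewrite invmx_unitary // in BE.
pose d i := complex.Re (D 0 i).
have dE i : D 0 i = (d i)%:C%C by rewrite RRe_real // (mxOverP Dreal).
pose w (k : bool * 'I_p) : 'rV[R]_p :=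
  \row_j (if k.1 then complex.Im (P k.2 j) else complex.Re (P k.2 j)).
(* For complex u and v, the real part of u^* v is Re u Re v + Im u Im v: this produces the two outer
   products per eigenvector. It is used with [c := d] for [A] and with [c := 1] for the identity. *)
have sumE (c : 'I_p -> R) j l :
  complex.Re (\sum_i ((P i j)^* * (c i)%:C%C * P i l)) =
  (\sum_k c k.2 *: ((w k)^T *m w k)) j l.
  rewrite summxE raddf_sum /=.
  rewrite -(pair_bigA _ (fun b i => (c i *: ((w (b, i))^T *m w (b, i))) j l)) /=.
  rewrite exchange_big /=; apply: eq_bigr => i _.
  rewrite big_bool !mxE !big_ord1 !mxE /=.
  by case: (P i j) (P i l) => a b [a' b'] /=; ring.
exists d, w; split.
- have PB : P *m B = diag_mx D *m P.
    by rewrite BE !mulmxA (unitarymxP Pu) mul1mx.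
  case=> b i; apply/rowP => j; rewrite !mxE.
  have := congr1 (fun M : 'M_p => M i j) PB.
  rewrite mul_diag_mx !mxE dE => PBij.
  have {PBij} : ((if b then @complex.Im R else @complex.Re R)
    (\sum_l P i l * B l j)) = (if b then @complex.Im R else @complex.Re R)
     ((d i)%:C%C * P i j) by rewrite PBij.
  case: b; rewrite raddf_sum /= => PBij; under eq_bigr do rewrite !mxE /=.
  + move: PBij; case: (P i j) => a b /=; rewrite mul0r addr0 => <-.
    apply: eq_bigr => l _; rewrite mxE /=; case: (P i l) => a' b' /=; ring.
  + move: PBij; case: (P i j) => a b /=; rewrite mul0r subr0 => <-.
    apply: eq_bigr => l _; rewrite mxE /=; case: (P i l) => a' b' /=; ring.
- apply/matrixP => j l; rewrite -sumE.
  have := congr1 (fun M : 'M_p => complex.Re (M j l)) BE.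
  rewrite !mxE /= => ->; congr complex.Re; apply: eq_bigr => i _.
  by rewrite mul_mx_diag !mxE dE.
- transitivity (\sum_k (fun=> 1) k.2 *: ((w k)^T *m w k)); last first.
    by apply: eq_bigr => k _; rewrite scale1r.
  apply/matrixP => j l; rewrite -(sumE (fun=> 1)).
  have /(congr1 (fun M : 'M_p => complex.Re (M j l))) : P^t* *m P = 1%:M.
    by apply: mulmx1C; apply/unitarymxP.
  rewrite !mxE => E; transitivity (complex.Re ((j == l)%:R : R[i])).
    by case: (j == l).
  rewrite -E; congr complex.Re; apply: eq_bigr => i _.
  by rewrite !mxE mulr1.
Qed.

Lemma row_normsq_ge0 {p : nat} (v : 'rV[R]_p) : 0 <= (v *m v^T) 0 0.
Proof. by rewrite mxE sumr_ge0 // => i _; rewrite mxE -expr2 sqr_ge0. Qed.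

Lemma row_normsq_eq0 {p : nat} (v : 'rV[R]_p) : (v *m v^T) 0 0 = 0 -> v = 0.
Proof.
rewrite mxE => /eqP; rewrite psumr_eq0 => [/allP v0|i _]; last first.
  by rewrite mxE -expr2 sqr_ge0.
apply/rowP => i; have := v0 i (mem_index_enum i).
by rewrite !mxE -expr2 sqrf_eq0 => /eqP.
Qed.

Lemma tr_mul_rank1 {p : nat} (A : 'M[R]_p) (w : 'rV[R]_p) :
  \tr (w^T *m w *m A) = (w *m A *m w^T) 0 0.
Proof. by rewrite -mulmxA mxtrace_mulC /mxtrace big_ord1. Qed.

Lemma psd_outer {p : nat} (v : 'rV[R]_p) : psd (v^T *m v).
Proof.
split=> [|u]; first by rewrite trmx_mul trmxK.
have -> : u *m (v^T *m v) *m u^T = (u *m v^T) *m (u *m v^T)^T.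
  by rewrite trmx_mul trmxK !mulmxA.
exact: row_normsq_ge0.
Qed.

(** The decomposition writes both traces as sums of the nonnegative numbers [w k *m S *m (w k)^T],
    weighted by 1 and by the eigenvalues; the smallest [d] carried by a nonzero [w k] gives the
    bound and is attained. *)
Lemma lambda_min_spec {p : nat} (A : 'M[R]_p) : (0 < p)%N -> A^T = A ->
  (forall S, psd S -> lambda_min A * \tr S <= \tr (A *m S)) /\
  exists2 v : 'rV[R]_p, v *m A = lambda_min A *: v & (v *m v^T) 0 0 = 1.
Proof.
move=> p_gt0 /sym_eigen_decomposition[d [w [wA AE IE]]].
have trE (S : 'M[R]_p) : \tr S = \sum_k (w k *m S *m (w k)^T) 0 0.
  rewrite -{1}[S]mul1mx IE mulmx_suml raddf_sum; apply: eq_bigr => k _ /=.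
  by rewrite tr_mul_rank1.
have [k0 w0] : exists k, w k != 0.
  apply/existsP; apply: contraT; rewrite negb_exists => /forallP w0.
  have := congr1 (fun M : 'M_p => M (Ordinal p_gt0) (Ordinal p_gt0)) IE.
  rewrite big1 => [/eqP|k _]; first by rewrite !mxE eqxx oner_eq0.
  by have /eqP-> := negbNE (w0 k); rewrite mulmx0.
case: (@arg_minP _ R _ k0 (fun k => w k != 0) (fun k => d k.2) w0).
move=> {}k0 {}w0 k0_min.
have low S : psd S -> d k0.2 * \tr S <= \tr (A *m S).
  move=> [_ Sp]; rewrite trE AE mulmx_suml raddf_sum mulr_sumr.
  apply: ler_sum => k _ /=; rewrite -scalemxAl mxtraceZ tr_mul_rank1.
  have [->|wk] := eqVneq (w k) 0; first by rewrite !mul0mx mxE !mulr0.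
  by rewrite ler_wpM2r // k0_min.
have norm_gt0 (v : 'rV[R]_p) : v != 0 -> 0 < (v *m v^T) 0 0.
  move=> v0; rewrite lt_neqAle row_normsq_ge0 andbT eq_sym.
  by apply: contra_neq v0; apply: row_normsq_eq0.
have -> : lambda_min A = d k0.2.
  have lb : lbound [set a | eigenvalue A a]%classic (d k0.2).
    move=> a /= /eigenvalueP[v vA v0].
    (* Applied to [v^T *m v], the trace bound compares [d k0.2] with the eigenvalue [a] of [v]. *)
    have := low _ (psd_outer v).
    rewrite -[_ *m v]mulmx1 tr_mul_rank1 !mulmx1 mxtrace_mulC tr_mul_rank1.
    by rewrite vA -scalemxAl [leRHS]mxE ler_pM2r // norm_gt0.
  have mem : [set a | eigenvalue A a]%classic (d k0.2).
    by apply/eigenvalueP; exists (w k0).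
  apply/le_anti/andP; split.
    by apply: ge_inf => //; exists (d k0.2).
  by apply: lb_le_inf => //; exists (d k0.2).
split=> //; exists ((Num.sqrt ((w k0 *m (w k0)^T) 0 0))^-1 *: w k0).
  by rewrite -scalemxAl wA !scalerA mulrC.
rewrite linearZ /= -scalemxAl -scalemxAr scalerA mxE.
rewrite -invfM -expr2 sqr_sqrtr ?row_normsq_ge0 // mulVf //.
by rewrite gt_eqF // norm_gt0.
Qed.

End SymmetricMatrices.

(** [M] is the congruence [C *m B *m C^T], where row [i] of [C] has at most one nonzero entry, [f i]
    in column [g i]. *)
Lemma psd_pullback {R : realType} {N k : nat} (M : 'M[R]_N) (B : 'M[R]_k)
    (f : 'I_N -> R) (g : 'I_N -> 'I_k) :
  psd B -> (forall i j, M i j = f i * f j * B (g i) (g j)) -> psd M.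
Proof.
move=> [Bsym Bpos] ME; pose C : 'M[R]_(N, k) := \matrix_(i, l) (f i *+ (l == g i)).
have sumC (h : 'I_k -> R) i : \sum_l C i l * h l = f i * h (g i).
  rewrite (bigD1 (g i)) //= mxE eqxx mulr1n big1 => [|l /negPf lg].
    by rewrite addr0.
  by rewrite mxE lg mul0r.
have -> : M = C *m B *m C^T.
  apply/matrixP => i j; transitivity (\sum_l C j l * (C *m B) i l).
    rewrite sumC; transitivity (f j * (\sum_l C i l * B l (g j))).
      by rewrite sumC ME; ring.
    by rewrite [in RHS]mxE.
  by rewrite [RHS]mxE; apply: eq_bigr => l _; rewrite [C^T _ _]mxE mulrC.
split=> [|u]; first by rewrite !trmx_mul trmxK Bsym mulmxA.
have -> : u *m (C *m B *m C^T) *m u^T = (u *m C) *m B *m (u *m C)^T.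
  by rewrite trmx_mul !mulmxA.
exact: Bpos.
Qed.

(** * Monomials and evaluation of polynomial matrices *)

Section Monomials.
Context {R : realType} {n : nat}.

Definition monomial (z : 'rV[R]_n) (a : 'X_{1..n}) : R :=
  \prod_(i < n) z 0 i ^+ a i.

Lemma monomialD z a b : monomial z (a + b)%MM = monomial z a * monomial z b.
Proof.
by rewrite /monomial -big_split; apply: eq_bigr => i _; rewrite mnmDE exprD.
Qed.

Lemma monomialU z k : monomial z U_(k)%MM = z 0 k.
Proof.
rewrite /monomial (bigD1 k) //= big1 => [|i /negPf ik].
  by rewrite mnm1E eqxx expr1 mulr1.
by rewrite mnm1E eq_sym ik expr0.
Qed.

Lemma eq_monomial (z z' : 'rV[R]_n) (a : 'X_{1..n}) :
  (forall i, i \in supp a -> z 0 i = z' 0 i) -> monomial z a = monomial z' a.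
Proof.
move=> eqz; apply: eq_bigr => i _.
have [->|ai] := eqVneq (a i) 0%N; first by rewrite !expr0.
by rewrite eqz // inE.
Qed.

Lemma msize_mxdegree {k} (P : 'M[{mpoly R[n]}]_k) i j d :
  (mxdegree P <= d)%N -> (msize (P i j) <= d.+1)%N.
Proof.
move=> Pd; rewrite (leq_trans (leqSpred _)) // ltnS (leq_trans _ Pd) //.
by rewrite /mxdegree (bigop.bigmax_sup i) // (bigop.bigmax_sup j).
Qed.

Lemma mxcoef_neq0_mdeg {k} (P : 'M[{mpoly R[n]}]_k) a :
  mxcoef P a != 0 -> (mdeg a <= mxdegree P)%N.
Proof.
apply: contra_neqT; rewrite -ltnNge => Pa; apply/matrixP => i j.
rewrite !mxE; apply: memN_msupp_eq0; apply: msize_mdeg_ge.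
exact: leq_trans (msize_mxdegree i j (leqnn _)) Pa.
Qed.

Lemma mxevalE {k} (P : 'M[{mpoly R[n]}]_k) z d : (mxdegree P <= d)%N ->
  mxeval P z = \sum_(a : 'X_{1..n < d.+1}) monomial z a *: mxcoef P a.
Proof.
move=> Pd; apply/matrixP => i j.
rewrite mxE {1}(mpolywE (msize_mxdegree i j Pd)) summxE raddf_sum /=.
by apply: eq_bigr => a _; rewrite mevalZ mevalX !mxE mulrC.
Qed.

Lemma eq_mxeval {k} (P : 'M[{mpoly R[n]}]_k) (z z' : 'rV[R]_n) :
  (forall i, occurs P i -> z 0 i = z' 0 i) -> mxeval P z = mxeval P z'.
Proof.
move=> eqz; rewrite !(mxevalE _ (leqnn _)); apply: eq_bigr => a _.
have [->|Pa] := eqVneq (mxcoef P a) 0; first by rewrite !scaler0.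
by congr (_ *: _); apply: eq_monomial => i ia; apply: eqz; exists (a : 'X_{1..n}).
Qed.

Lemma mxeval_sym {k} (P : 'M[{mpoly R[n]}]_k) z :
  P^T = P -> (mxeval P z)^T = mxeval P z.
Proof. by move=> Psym; rewrite /mxeval map_trmx Psym. Qed.

End Monomials.

(** * Moment sequence of a rank-one point mass *)

Section PointMass.
Context {R : realType} {n p : nat}.
Variables (r : nat) (z : 'rV[R]_n) (v : 'rV[R]_p).

Definition pointmass : moment_seq R n p r :=
  [ffun a : 'X_{1..n < (2 * r).+1} => monomial z a *: (v^T *m v)].

Lemma entryE (S : moment_seq R n p r) (a : 'X_{1..n < (2 * r).+1}) :
  entry S a = S a.
Proof. by rewrite /entry valK. Qed.

Lemma entry_pointmass a : (mdeg a <= 2 * r)%N ->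
  entry pointmass a = monomial z a *: (v^T *m v).
Proof. by move=> ar; rewrite /entry insubT ffunE. Qed.

Lemma mdeg_mindex {d} {A : {set 'I_n}} (i : 'I_#|mbasis d A|) :
  (mdeg (mindex i) <= d)%N.
Proof. by rewrite -ltnS bmdeg. Qed.

Lemma riesz_pointmass (P : 'M[{mpoly R[n]}]_p) : (mxdegree P <= 2 * r)%N ->
  riesz pointmass P = \tr (mxeval P z *m (v^T *m v)).
Proof.
move=> Pr; rewrite (mxevalE _ Pr) mulmx_suml raddf_sum; apply: eq_bigr => a _.
by rewrite ffunE -scalemxAl -scalemxAr.
Qed.

Lemma mxdegree_half_degree {k} (P : 'M[{mpoly R[n]}]_k) :
  (mxdegree P <= 2 * half_degree P)%N.
Proof. by rewrite /half_degree mul2n -leq_uphalf_double. Qed.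

(** The matrix is the outer product of [f] with itself, that is, a pullback of the 1x1 identity. *)
Lemma psd_pointmass_moment A : psd (moment_mx pointmass r A).
Proof.
pose f (x : 'I_(\sum_(i < #|@mbasis n r A|) p)) :=
  monomial z (mindex (tagnat.sig1 x)) * v 0 (tagnat.sig2 x).
apply: (@psd_pullback R _ 1 _ 1%:M f (fun=> ord0 : 'I_1)) => [|x y].
  by split=> [|u]; rewrite ?trmx1 // mulmx1 row_normsq_ge0.
rewrite mxE entry_pointmass.
  by rewrite !mxE big_ord1 !mxE monomialD /f mulr1; ring.
by rewrite mdegD mul2n -addnn leq_add // mdeg_mindex.
Qed.

(** Summing over the coefficients of [P] turns each entry into [f x * f y] times an entry of
    [mxeval P z], selected by the second tensor index. *)
Lemma psd_pointmass_localizing {k} (P : 'M[{mpoly R[n]}]_k) A :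
  (half_degree P <= r)%N -> psd (mxeval P z) ->
  psd (localizing_mx pointmass P (r - half_degree P) A).
Proof.
move=> Pr Pz.
pose f (x : 'I_(\sum_(i < #|@mbasis n (r - half_degree P) A|) (p * k))) :=
  monomial z (mindex (tagnat.sig1 x)) *
  v 0 (mxtens_unindex (tagnat.sig2 x)).1.
apply: (psd_pullback (f := f)
  (g := fun x => (mxtens_unindex (tagnat.sig2 x)).2) Pz) => x y.
rewrite mxE (mxevalE _ (leqnn _)) !summxE mulr_sumr; apply: eq_bigr => c _.
(* The total degree is at most 2(r - h) + 2h = 2r with h the half degree of [P], so [entry] never
   takes its default value. *)
rewrite entry_pointmass; last first.
  have := mdeg_mindex (tagnat.sig1 x); have := mdeg_mindex (tagnat.sig1 y).
  have := bmdeg c; have := mxdegree_half_degree P; rewrite !mdegD; move: Pr; lia.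
rewrite !monomialD !mxE big_ord1 !mxE /f; ring.
Qed.

End PointMass.

(** * The relaxation as a lower bound *)

Section Bounds.
Context {R : realType} {n p m t : nat} {q : 'I_m -> nat}.
Variables (F : 'M[{mpoly R[n]}]_p) (G : forall k : 'I_m, 'M[{mpoly R[n]}]_(q k)).
Variables (I : 'I_t -> {set 'I_n}) (J : 'I_t -> {set 'I_m}) (r : nat).

Lemma half_degree_r_min : (half_degree F <= r_min F G)%N.
Proof. exact: leq_maxl. Qed.

Lemma half_degree_constraint k : (half_degree (G k) <= r_min F G)%N.
Proof. by rewrite /r_min leq_max (bigop.bigmax_sup k) ?orbT. Qed.

Lemma mxdegree_r_min : (r_min F G <= r)%N -> (mxdegree F <= 2 * r)%N.
Proof.
move=> rr; rewrite (leq_trans (mxdegree_half_degree F)) // leq_mul2l /=.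
exact: leq_trans half_degree_r_min rr.
Qed.

Lemma mxdegree1 : mxdegree (1%:M : 'M[{mpoly R[n]}]_p) = 0%N.
Proof.
apply/eqP; rewrite -leqn0; apply/bigmax_leqP => i _; apply/bigmax_leqP => j _.
by rewrite mxE; case: (i == j); rewrite ?msize1 ?msize0.
Qed.

Lemma mxeval1 (z : 'rV[R]_n) : mxeval (1%:M : 'M[{mpoly R[n]}]_p) z = 1%:M.
Proof.
by apply/matrixP => i j; rewrite !mxE; case: (i == j); rewrite ?meval1 ?meval0.
Qed.

(* The moments of the measure [v^T v delta_z], with [v] a unit eigenvector of
   [F z] for its least eigenvalue, form a feasible point of the relaxation. *)
Lemma cs_value_le_pmo_value : (0 < p)%N -> F^T = F -> (r_min F G <= r)%N ->
  (cs_value F G I J r <= pmo_value F G)%E.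
Proof.
move=> p_gt0 Fsym rr; apply: le_ereal_inf_tmp => _ [z /= zG <-].
have [_ [v vF v1]] := lambda_min_spec p_gt0 (mxeval_sym z Fsym).
apply: ge_ereal_inf; exists (riesz (pointmass r z v) F)%:E; last first.
  rewrite riesz_pointmass ?mxdegree_r_min // mxtrace_mulC tr_mul_rank1 vF.
  by rewrite -scalemxAl mxE v1 mulr1.
exists (pointmass r z v) => //; split.
- by move=> a; rewrite ffunE linearZ /= (psd_outer v).1.
- by move=> l; apply: psd_pointmass_moment.
- move=> l k _; apply: psd_pointmass_localizing (zG k).
  exact: leq_trans (half_degree_constraint k) rr.
- rewrite riesz_pointmass ?mxdegree1 // mxeval1 mxtrace_mulC tr_mul_rank1.
  by rewrite mulmx1.
Qed.

End Bounds.

(** * Maximal cliques of the sparsity graph *)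

Section Cliques.
Context {R : realType} {n p m t : nat} {q : 'I_m -> nat}.
Variables (F : 'M[{mpoly R[n]}]_p) (G : forall k : 'I_m, 'M[{mpoly R[n]}]_(q k)).
Variables (I : 'I_t -> {set 'I_n}) (J : 'I_t -> {set 'I_m}).
Hypothesis IJ : csp_decomposition F G I J.

Lemma clique_subset A : csp_clique F G A -> exists l, A \subset I l.
Proof.
move=> /asboolP cA.
have [B /maxsetP[/asboolP cB Bmax] AB] :=
  @maxset_exists _ (fun A => `[< csp_clique F G A >]) A cA.
have [l Bl] : exists l, B = I l.
  apply/(csp_cliques IJ); split=> // B' /asboolP cB' BB'.
  by rewrite (Bmax B').
by exists l; rewrite -Bl.
Qed.

Lemma supp_subset a : mxcoef F a != 0 -> exists l, supp a \subset I l.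
Proof.
move=> Fa; apply: clique_subset => i j ia ja ij; split=> //; left.
by exists a => //; rewrite ia ja.
Qed.

Lemma supp_nonzero (a : 'X_{1..n}) i : i \in supp a -> (0 < mdeg a)%N.
Proof.
rewrite lt0n mdeg_eq0 inE; apply: contra_neqN => /eqP->.
by rewrite mnm0E.
Qed.

Lemma half_degree_gt0 {k} (P : 'M[{mpoly R[n]}]_k) i :
  occurs P i -> (0 < half_degree P)%N.
Proof.
move=> [a Pa /supp_nonzero a0]; have := mxcoef_neq0_mdeg Pa.
by have := mxdegree_half_degree P; lia.
Qed.

(** If [r_min] were 0, then [F] and all [G k] would be constant and the graph would have no edge;
    maximal cliques meeting in a vertex would be the same singleton. Positivity makes the degree-one
    monomials available as indices of the moment matrix. *)
Lemma overlap_r_min_gt0 l l' :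
  l != l' -> I l :&: I l' != finset.set0 -> (0 < r_min F G)%N.
Proof.
move=> ll'; apply: contra_neqT; rewrite lt0n negbK => /eqP r0.
have adjN i j : ~ csp_adj F G i j.
  move=> [_ [[a Fa /andP[ia _]]|[k [Gi _]]]].
    have /half_degree_gt0 : occurs F i by exists a.
    by have := half_degree_r_min F G; rewrite r0; lia.
  have /half_degree_gt0 := Gi.
  by have := half_degree_constraint F G k; rewrite r0; lia.
have cliqueE k i : k \in I i -> I i = [set k]%SET.
  move=> ki; apply/setP => j; rewrite !inE; apply/idP/eqP => [ji|->//].
  have [ci _] : csp_maxclique F G (I i) by apply/(csp_cliques IJ); exists i.
  by have [//|jk] := eqVneq j k; case: (@adjN j k); apply: ci.
apply/setP => k; rewrite !inE; apply/negP => /andP[kl kl'].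
case/eqP: ll'; apply: (csp_injective IJ).
by rewrite (cliqueE _ _ kl) (cliqueE _ _ kl').
Qed.

End Cliques.

Lemma rank1_minor {K : fieldType} {m n : nat} (M : 'M[K]_(m, n)) i j k l :
  \rank M = 1%N -> M i j * M k l = M i l * M k j.
Proof.
move=> rk; move: (col_base M) (row_base M) (mulmx_base M); rewrite rk.
by move=> c w <-; rewrite !mxE !big_ord1; ring.
Qed.

(** * Restriction to a clique and extension by zero *)

Section Subvectors.
Context {R : realType} {n : nat}.
Implicit Types (A : {set 'I_n}) (z : 'rV[R]_n).

Lemma extend_enum_val {A} (y : 'rV[R]_#|A|) j : extend y 0 (enum_val j) = y 0 j.
Proof.
rewrite mxE (bigD1 j) //= big1 ?addr0 // => i /andP[/eqP/enum_val_inj->].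
by rewrite eqxx.
Qed.

Lemma enum_valE A k : k \in A -> exists j : 'I_#|A|, k = enum_val j.
Proof. by move=> kA; exists (enum_rank_in kA k); rewrite enum_rankK_in. Qed.

Lemma extend_subvec A z k : k \in A -> extend (subvec A z) 0 k = z 0 k.
Proof. by move=> /enum_valE[j ->]; rewrite extend_enum_val mxE. Qed.

Lemma submonomialE {A} (a : 'X_{1..n}) (y : 'rV[R]_#|A|) : supp a \subset A ->
  submonomial a y = monomial (extend y) a.
Proof.
move=> aA; rewrite /monomial (bigID (mem A)) /= [X in _ * X]big1 ?mulr1; last first.
  move=> i /(contra (fintype.subsetP aA i)); rewrite inE negbK => /eqP->.
  by rewrite expr0.
rewrite big_enum_val /=; apply: eq_bigr => j _.
by rewrite extend_enum_val.
Qed.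

End Subvectors.

(** * Atoms of the clique measures *)

Section Atoms.
Context {R : realType} {n p r : nat}.
Variables (S : moment_seq R n p r) (A : {set 'I_n}) (K : set 'rV[R]_#|A|).
Variables (s : nat) (xi : 'I_s -> R) (x : 'I_s -> 'rV[R]_#|A|).
Hypothesis S_repr : representing_measure S K (fun i => xi i *: entry S 0%MM) x.

(** All weights are multiples of the single matrix S_0, so each matrix moment is a scalar moment of
    the weights [xi] times S_0. *)
Lemma entry_repr a : (mdeg a <= 2 * r)%N -> supp a \subset A ->
  entry S a = (\sum_i xi i * monomial (extend (x i)) a) *: entry S 0%MM.
Proof.
move=> ar aA; rewrite -ltnS in ar; have -> : a = BMultinom ar by [].
rewrite entryE (rm_moments S_repr) // scaler_suml; apply: eq_bigr => i _ /=.
by rewrite scalerA submonomialE // mulrC.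
Qed.

Hypotheses (xi_gt0 : forall i, 0 < xi i) (xi_sum1 : \sum_i xi i = 1).

(* A 2x2 minor of the moment matrix through the monomials 1 and x_k is, up to
   a nonzero factor, the variance of the coordinate k under the weights xi. *)
Lemma rank1_coordinate_constant (B : {set 'I_n}) u k i :
  (0 < r)%N -> B \subset A -> \rank (moment_mx S r B) = 1%N -> k \in B ->
  entry S 0%MM u u != 0 ->
  extend (x i) 0 k = entry S U_(k)%MM u u / entry S 0%MM u u.
Proof.
move=> r_gt0 BA rk kB Su.
have supp0 : supp (0%MM : 'X_{1..n}) \subset B.
  by apply/fintype.subsetP => j; rewrite inE mnm0E.
have suppk : supp U_(k)%MM \subset B.
  apply/fintype.subsetP => j; rewrite inE mnm1E.
  by case: (k =P j) => [<-|].
have index (a : 'X_{1..n}) : (mdeg a <= r)%N -> supp a \subset B ->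
    exists j : 'I_#|@mbasis n r B|, mindex j = a.
  rewrite -ltnS => ar aB; have aM : BMultinom ar \in mbasis r B by rewrite inE.
  by exists (enum_rank_in aM (BMultinom ar)); rewrite /mindex enum_rankK_in.
have [i0 i0E] := index 0%MM (leq_trans (eq_leq mdeg0) (leq0n r)) supp0.
have [i1 i1E] := index U_(k)%MM (leq_trans (eq_leq (mdeg1 k)) r_gt0) suppk.
(* [e j u] is position [u] inside block [j]; fixing [u] extracts a scalar moment matrix from the
   block matrix. *)
pose e i j : 'I_(\sum_(l < #|@mbasis n r B|) p) := @tagnat.Rank _ (fun=> p) i j.
have mmE j j' : moment_mx S r B (e j u) (e j' u) =
    entry S (mindex j + mindex j')%MM u u.
  have := congr1 (fun M : 'M_p => M u u)
    (mxblockK (fun j j' => entry S (mindex j + mindex j')%MM) j j').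
  by rewrite mxE.
have [c cE] : exists c, c = \sum_i xi i * extend (x i) 0 k by eexists.
have Sk : entry S U_(k)%MM = c *: entry S 0%MM.
  rewrite entry_repr ?(fintype.subset_trans suppk) // ?mdeg1 ?muln_gt0 //.
  by rewrite cE; congr (_ *: _); apply: eq_bigr => j _; rewrite monomialU.
have Skk : entry S (U_(k) + U_(k))%MM =
    (\sum_i xi i * extend (x i) 0 k ^+ 2) *: entry S 0%MM.
  have suppkk : supp (U_(k) + U_(k))%MM \subset A.
    apply/fintype.subsetP => j; rewrite inE mnmDE mnm1E.
    by case: (k =P j) => [<- _|//]; rewrite (fintype.subsetP BA).
  rewrite entry_repr ?mdegD ?mdeg1 ?leq_pmulr //.
  by congr (_ *: _); apply: eq_bigr => j _; rewrite monomialD monomialU expr2.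
have var0 : \sum_i xi i * (extend (x i) 0 k - c) ^+ 2 = 0.
  have -> : \sum_i xi i * (extend (x i) 0 k - c) ^+ 2 =
      \sum_i xi i * extend (x i) 0 k ^+ 2 - c ^+ 2.
    transitivity (\sum_i xi i * extend (x i) 0 k ^+ 2 
      - 2 * c * (\sum_i xi i * extend (x i) 0 k) + c ^+ 2 * \sum_i xi i).
      2: by rewrite xi_sum1 -cE; ring.
    rewrite !mulr_sumr -sumrB -big_split; apply: eq_bigr => j _ /=; ring.
  have := rank1_minor (e i0 u) (e i0 u) (e i1 u) (e i1 u) rk.
  rewrite !mmE i0E i1E !add0m !addm0 Skk Sk.
  have scE (a : R) (M : 'M_p) : (a *: M) u u = a * M u u by rewrite mxE.
  rewrite !scE => minor; apply/eqP; rewrite subr_eq0; apply/eqP.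
  apply: (mulIf Su); apply: (mulIf Su).
  by rewrite -mulrA mulrCA minor; ring.
have ic : extend (x i) 0 k = c.
  apply/eqP; rewrite -subr_eq0 -sqrf_eq0.
  move/eqP: var0; rewrite psumr_eq0 => [/allP/(_ i (mem_index_enum i))|j _].
    by rewrite mulf_eq0 gt_eqF.
  by rewrite mulr_ge0 ?sqr_ge0 // ltW.
by rewrite ic Sk mxE mulfK.
Qed.

End Atoms.

(** Choosing a minimizer of every [h l] makes all gaps between mean and value nonnegative, while the
    assumption bounds their sum by 0. All gaps vanish, and positive weights force each [h l] to be
    constant. *)
Lemma sum_choice_const {R : realType} {t : nat} {s : 'I_t -> nat}
    (xi h : forall l, 'I_(s l) -> R) :
  (forall l i, 0 < xi l i) -> (forall l, \sum_i xi l i = 1) ->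
  (forall f : forall l, 'I_(s l),
    \sum_l \sum_i xi l i * h l i <= \sum_l h l (f l)) ->
  forall f : forall l, 'I_(s l),
    \sum_l h l (f l) = \sum_l \sum_i xi l i * h l i.
Proof.
move=> xi_gt0 xi1 hV f.
pose g l := [arg min_(i < f l) h l i]%O.
have gh l i : h l (g l) <= h l i.
  by rewrite /g; case: arg_minP => // j _ /(_ i isT).
have term_ge0 l i : 0 <= xi l i * (h l i - h l (g l)).
  by rewrite mulr_ge0 ?(ltW (xi_gt0 _ _)) // subr_ge0.
have gapE : \sum_l \sum_i xi l i * (h l i - h l (g l)) =
    \sum_l \sum_i xi l i * h l i - \sum_l h l (g l).
  rewrite -sumrB; apply: eq_bigr => l _.
  under eq_bigr do rewrite mulrBr.
  by rewrite sumrB -mulr_suml xi1 mul1r.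
have gap0 : \sum_l \sum_i xi l i * (h l i - h l (g l)) = 0.
  apply/le_anti/andP; split; first by rewrite gapE subr_le0 hV.
  by rewrite sumr_ge0 // => l _; rewrite sumr_ge0.
have hg l i : h l i = h l (g l).
  move/eqP: gap0; rewrite psumr_eq0 => [|j _]; last by rewrite sumr_ge0.
  move=> /allP/(_ l (mem_index_enum l)) /=; rewrite psumr_eq0 => [|//].
  move=> /allP/(_ i (mem_index_enum i)) /=.
  by rewrite mulf_eq0 gt_eqF //= subr_eq0 => /eqP.
move/eqP: gapE; rewrite gap0 eq_sym subr_eq0 => /eqP->.
by apply: eq_bigr => l _; rewrite hg.
Qed.

Lemma psd_unscale {R : realType} {k : nat} (c : R) (A : 'M[R]_k) :
  0 < c -> psd (c *: A) -> psd A.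
Proof.
move=> c_gt0 cA.
apply: (@psd_pullback _ _ _ A _ (fun=> Num.sqrt c^-1) id cA) => i j.
by rewrite -expr2 sqr_sqrtr ?invr_ge0 ?ltW // mxE mulKf // gt_eqF.
Qed.

(** Each constraint lies in some [J l] and involves only variables of [I l], so it takes the same
    value at [z] and at the zero extension of its restriction. *)
Lemma feasible_glued {R : realType} {n m p t : nat} {q : 'I_m -> nat}
    (F : 'M[{mpoly R[n]}]_p) (G : forall k : 'I_m, 'M[{mpoly R[n]}]_(q k))
    (I : 'I_t -> {set 'I_n}) (J : 'I_t -> {set 'I_m}) (z : 'rV[R]_n) :
  csp_decomposition F G I J ->
  (forall l, local_set G (I l) (J l) (subvec (I l) z)) -> feasible G z.
Proof.
move=> IJ zK k; have [l kl] := csp_cover IJ k.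
have := zK l k kl; congr psd; apply: eq_mxeval => i Gi.
by apply: extend_subvec; apply: (csp_vars IJ) kl Gi.
Qed.

(** * Gluing of atoms and comparison of the two values *)

Theorem theorem5p2 (R : realType) (n p m t : nat) (p_gt0 : (0 < p)%N)
  (q : 'I_m -> nat)
  (F : 'M[{mpoly R[n]}]_p) (F_sym : F^T = F)
  (G : forall k : 'I_m, 'M[{mpoly R[n]}]_(q k))
  (G_sym : forall k, (G k)^T = G k)
  (I : 'I_t -> {set 'I_n}) (J : 'I_t -> {set 'I_m})
  (IJ : csp_decomposition F G I J)
  (r : nat) (r_ge : (r_min F G <= r)%N)
  (S : moment_seq R n p r) (S_opt : cs_optimal F G I J S)
  (s : 'I_t -> nat) (xi : forall l : 'I_t, 'I_(s l) -> R)
  (x : forall l : 'I_t, 'I_(s l) -> 'rV[R]_#|I l|)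
  (xi_gt0 : forall l i, 0 < xi l i)
  (xi_sum1 : forall l, \sum_(i < s l) xi l i = 1)
  (S_repr : forall l, representing_measure S (local_set G (I l) (J l))
                        (fun i => xi l i *: entry S 0%MM) (x l))
  (S_rank1 : forall i j : 'I_t, i != j -> I i :&: I j != finset.set0 ->
               \rank (moment_mx S r (I i :&: I j)) = 1%N) :
  cs_value F G I J r = pmo_value F G /\
  (forall xhat : 'rV[R]_n,
     (forall l, exists i, subvec (I l) xhat = x l i) ->
     pmo_optimal F G xhat).
Proof.
have Fdeg := mxdegree_r_min r_ge.
have [S_feas S_value] := S_opt.
(* In the normalization only the constant coefficient of the identity contributes. *)
have trS0 : \tr (entry S 0%MM) = 1.
  rewrite -(cs_normalized S_feas) /riesz.
  rewrite (bigD1 (BMultinom (leq_ltn_trans (eq_leq mdeg0) (ltn0Sn (2 * r))))) //=.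
  rewrite big1 => [|a a0].
    rewrite addr0 -entryE /=; congr (\tr _).
    suff -> : mxcoef (1%:M : 'M[{mpoly R[n]}]_p) 0%MM = 1%:M by rewrite mul1mx.
    apply/matrixP => i j; rewrite !mxE.
    by case: (i == j); rewrite ?mcoeff1 ?mcoeff0 ?eqxx.
  have [->|/mxcoef_neq0_mdeg] := eqVneq (mxcoef (1%:M : 'M[{mpoly R[n]}]_p) a) 0.
    by rewrite mul0mx raddf0.
  by rewrite mxdegree1 leqn0 mdeg_eq0 => /eqP a00; case/eqP: a0; apply: val_inj.
(* A matrix of trace 1 has a nonzero diagonal entry, the divisor needed in the variance argument. *)
have [u Su] : exists u, entry S 0%MM u u != 0.
  apply/existsP; apply: contraT; rewrite negb_exists => /forallP S00.
  move/eqP: trS0; rewrite /mxtrace big1 1?eq_sym ?oner_eq0 // => u _.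
  by apply/eqP/negbNE.
have atom l : 'I_(s l).
  case: (s l) (xi l) (xi_sum1 l) => [|k] xil; last by move=> _; exact: ord0.
  by rewrite big_ord0 => /esym/eqP; rewrite oner_eq0.
(* The empty set is a clique, hence lies in a maximal one; this gives an index even when n = 0. *)
have [l0] : exists l : 'I_t, True.
  have [l _] : exists l, finset.set0 \subset I l; last by exists l.
  by apply: (clique_subset IJ) => i j; rewrite inE.
move=> _.
have S0psd : psd (entry S 0%MM).
  exact: psd_unscale (xi_gt0 l0 (atom l0)) (rm_psd (S_repr l0) _).
(* Both coordinates equal one ratio of entries of [S], which mentions neither clique nor atom. *)
have agree l l' i i' k : l != l' -> k \in I l -> k \in I l' ->
    extend (x l i) 0 k = extend (x l' i') 0 k.
  move=> ll' kl kl'; have kB : k \in I l :&: I l' by rewrite inE kl.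
  have B0 : I l :&: I l' != finset.set0 by apply/set0Pn; exists k.
  have r_gt0 := leq_trans (overlap_r_min_gt0 IJ ll' B0) r_ge.
  have rk := S_rank1 _ _ ll' B0.
  rewrite (rank1_coordinate_constant (S_repr l) (xi_gt0 l) (xi_sum1 l)
    i r_gt0 (finset.subsetIl _ _) rk kB Su).
  by rewrite (rank1_coordinate_constant (S_repr l') (xi_gt0 l') (xi_sum1 l')
    i' r_gt0 (finset.subsetIr _ _) rk kB Su).
have glue (f : forall l, 'I_(s l)) : exists z, forall l, subvec (I l) z = x l (f l).
  exists (\row_k if [pick l | k \in I l] is Some l then extend (x l (f l)) 0 k else 0).
  move=> l; apply/rowP => j; rewrite !mxE -(extend_enum_val (x l (f l))).
  move: (enum_val j) (enum_valP j) => k kl.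
  case: pickP => [l' kl'|/(_ l)]; last by rewrite kl.
  by have [->//|ll'] := eqVneq l' l; apply: agree.
have feas z : (forall l, exists i, subvec (I l) z = x l i) -> feasible G z.
  move=> zx; apply: (feasible_glued IJ) => l; have [i ->] := zx l.
  exact: rm_atoms (S_repr l) i.
(* The default [l0] is reached only by monomials whose coefficient in [F] is zero. *)
pose L (a : 'X_{1..n}) := odflt l0 [pick l | supp a \subset I l].
have LP a : mxcoef F a != 0 -> supp a \subset I (L a).
  move=> /(supp_subset IJ)[l al]; rewrite /L; case: pickP => //= /(_ l).
  by rewrite al.
pose h l i := \sum_(a : 'X_{1..n < (2 * r).+1} | L a == l)
  monomial (extend (x l i)) a * \tr (mxcoef F a *m entry S 0%MM).
have riesz_h : riesz S F = \sum_l \sum_i xi l i * h l i.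
  rewrite /riesz (partition_big (fun a : 'X_{1..n < (2 * r).+1} => L a) xpredT) //=.
  apply: eq_bigr => l _; under [RHS]eq_bigr do rewrite mulr_sumr.
  rewrite [RHS]exchange_big /=; apply: eq_bigr => a /eqP La.
  have [->|/LP] := eqVneq (mxcoef F a) 0.
    by rewrite mul0mx raddf0 big1 // => i _; rewrite mul0mx raddf0 !mulr0.
  rewrite La -entryE => al; rewrite (entry_repr (S_repr l) _ al); last first.
    by rewrite -ltnS bmdeg.
  rewrite -scalemxAr mxtraceZ mulr_suml; apply: eq_bigr => i _.
  by rewrite mulrA.
have eval_h z f : (forall l, subvec (I l) z = x l (f l)) ->
    \tr (mxeval F z *m entry S 0%MM) = \sum_l h l (f l).
  move=> zx; rewrite (mxevalE z Fdeg) mulmx_suml raddf_sum /=.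
  rewrite (partition_big (fun a : 'X_{1..n < (2 * r).+1} => L a) xpredT) //=.
  apply: eq_bigr => l _; apply: eq_bigr => a /eqP La.
  rewrite -scalemxAl mxtraceZ; have [->|/LP] := eqVneq (mxcoef F a) 0.
    by rewrite mul0mx raddf0 !mulr0.
  rewrite La => al; congr (_ * _); apply: eq_monomial => k /(fintype.subsetP al) kl.
  by rewrite -zx extend_subvec.
have lower z : lambda_min (mxeval F z) <= \tr (mxeval F z *m entry S 0%MM).
  have [/(_ _ S0psd)] := lambda_min_spec p_gt0 (mxeval_sym z F_sym).
  by rewrite trS0 mulr1.
have relax : (cs_value F G I J r <= pmo_value F G)%E.
  exact: cs_value_le_pmo_value.
have pmo_le z : feasible G z -> (pmo_value F G <= (lambda_min (mxeval F z))%:E)%E.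
  by move=> zG; apply: ereal_inf_lbound; exists z.
have h_const := sum_choice_const xi_gt0 xi_sum1 (h := h).
(* For a glued point [z], the chain is [riesz S F] = relaxed value <= true value <=
   [lambda_min (mxeval F z)] <= the trace against S_0 = the sum of the [h l]. *)
have {}h_const f : \sum_l h l (f l) = riesz S F.
  rewrite riesz_h; apply: h_const => g; rewrite -riesz_h.
  have [z zx] := glue g; rewrite -(eval_h _ _ zx) -lee_fin S_value.
  apply: le_trans relax (le_trans (pmo_le z _) _); last by rewrite lee_fin.
  by apply: feas => l; exists (g l).
have opt z : (forall l, exists i, subvec (I l) z = x l i) ->
    feasible G z /\ (lambda_min (mxeval F z))%:E = cs_value F G I J r.
  move=> zx; have zG := feas z zx; split=> //.
  pose f l := sval (cid (zx l)).
  have zf l : subvec (I l) z = x l (f l) := svalP (cid (zx l)).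
  (* The remaining inequality is [lower], since the trace at [z] now equals the relaxed value. *)
  apply/le_anti/andP; split; last exact: le_trans relax (pmo_le z zG).
  by rewrite -S_value -(h_const f) -(eval_h _ _ zf) lee_fin.
have value_eq : cs_value F G I J r = pmo_value F G.
  have [z zx] := glue atom.
  have [zG zv] : feasible G z /\ (lambda_min (mxeval F z))%:E = cs_value F G I J r.
    by apply: opt => l; exists (atom l).
  by apply/le_anti; rewrite relax -zv pmo_le.
by split=> // z /opt[zG zv]; split; rewrite // -value_eq.
Qed.
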